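(* Let $\Omega\subseteq\mathbb{R}^n$ be open, let $u\in\mathcal{E}^C(\Omega)$ and let $\mathcal{J}:=\{I_0^{\mathrm{d}}(\Omega)\}$. Then: (i) $u\in\mathcal{E}_M^C(\Omega)$ if and only if $\forall K\Subset\Omega\ \forall\alpha\in\mathbb{N}^n\ \exists N\in\mathbb{N}:\ \sup_{x\in K}|\partial^\alpha u_\varepsilon(x)|=O_{\mathcal{J}}(\underline{\varepsilon}^{-N})$ as $\varepsilon\in\mathbb{I}^{\mathrm{d}}(\Omega)$; (ii) if $u\in\mathcal{E}_M^C(\Omega)$, then $u\in\mathcal{N}^C(\Omega)$ if and only if $\forall K\Subset\Omega\ \forall\alpha\in\mathbb{N}^n\ \forall m\in\mathbb{N}:\ \sup_{x\in K}|\partial^\alpha u_\varepsilon(x)|=O(\underline{\varepsilon}^{m})$ as $\varepsilon\in\mathbb{I}^{\mathrm{d}}(\Omega)$.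
   Context: $\mathbb{N}=\{0,1,2,\dots\}$, $n\ge1$; $K\Subset\Omega$ means $K$ is a compact subset of $\Omega$. For $\varphi\in\mathcal{D}(\mathbb{R}^n)$, $r>0$: $(r\odot\varphi)(y):=r^{-n}\varphi(y/r)$. $\mathcal{A}_0:=\{\varphi\in\mathcal{D}(\mathbb{R}^n)\mid\int\varphi=1\}$, $\mathcal{A}_q:=\{\varphi\in\mathcal{A}_0\mid\int x^\alpha\varphi(x)\,dx=0\ \forall\, 1\le|\alpha|\le q\}$. $U(\Omega):=\{(\varphi,x)\in\mathcal{A}_0\times\Omega\mid\mathrm{supp}(\varphi)\subseteq\Omega-x\}$. Smoothness: smoothness for the infinite-dimensional spaces is in the usual diffeological/convenient sense. A map $p$ from $(0,1]\times\Omega$, or from an open subset of some $\mathbb{R}^k$, into $\mathcal{A}_q$ is smooth iff $(t,y)\mapsto p(t)(y)$ is smooth and, locally in $t$, the supports of $p(t)$ lie in a common compact set. A function $R:U(\Omega)\to\mathbb{R}$ is smooth iff $R\circ p$ is smooth for every smooth map $p$ from an open subset of some $\mathbb{R}^k$ into $U(\Omega)\subseteq\mathcal{A}_0\times\Omega$. $\mathcal{E}^C(\Omega):=\mathcal{C}^\infty(U(\Omega),\mathbb{R})$. $\mathcal{C}^\infty_{\mathrm{b}}((0,1]\times\Omega,\mathcal{A}_q)$ is the set of $\varphi\in\mathcal{C}^\infty((0,1]\times\Omega,\mathcal{A}_q)$ such that for every $K\Subset\Omega$ there is a bounded $B\subseteq\mathbb{R}^n$ with $\mathrm{supp}[\partial^\alpha\varphi(r,x)]\subseteq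 B$ for all $\alpha\in\mathbb{N}^n$, $r\in(0,1]$, $x\in K$. It is identified with $\mathcal{C}^\infty_{\mathrm{b}}((0,1],\mathcal{C}^\infty(\Omega,\mathcal{A}_q))$ (smooth maps $r\mapsto\varphi_r\in\mathcal{C}^\infty(\Omega,\mathcal{A}_q)$ with the same boundedness condition) via $\varphi_r(x)=\varphi(r,x)$. $R\in\mathcal{E}^C_M(\Omega)$ iff $R\in\mathcal{E}^C(\Omega)$ and $\forall K\Subset\Omega\,\forall\alpha\in\mathbb{N}^n\,\exists N\in\mathbb{N}\,\forall\varphi\in\mathcal{C}^\infty_{\mathrm{b}}((0,1]\times\Omega,\mathcal{A}_0)$: $\sup_{x\in K}|\partial_x^\alpha R(r\odot\varphi(r,x),x)|=O(r^{-N})$ as $r\to0^+$. $R\in\mathcal{N}^C(\Omega)$ iff $R\in\mathcal{E}^C_M(\Omega)$ and $\forall K\Subset\Omega\,\forall\alpha\in\mathbb{N}^n\,\forall m\in\mathbb{N}\,\exists q\in\mathbb{N}\,\forall\varphi\in\mathcal{C}^\infty_{\mathrm{b}}((0,1]\times\Omega,\mathcal{A}_q)$: $\sup_{x\in K}|\partial_x^\alpha R(r\odot\varphi(r,x),x)|=O(r^{m})$ as $r\to0^+$. Index structure: $I_q^{\mathrm{d}}(\Omega):=(0,1]\times\mathcal{C}^\infty_{\mathrm{b}}((0,1],\mathcal{C}^\infty(\Omega,\mathcal{A}_q))$; $\mathbb{I}^{\mathrm{d}}(\Omega)=(I^{\mathrm{d}}(\Omega),\le,\mathcal{I}^{\mathrm{d}}(\Omega))$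 with $I^{\mathrm{d}}(\Omega):=I_0^{\mathrm{d}}(\Omega)$, $\mathcal{I}^{\mathrm{d}}(\Omega):=\{I_q^{\mathrm{d}}(\Omega)\mid q\in\mathbb{N}\}$, and $(r,\varphi)\le(s,\psi)$ iff $\varphi=\psi$ and $r\le s$. For $\varepsilon=(r,\varphi)\in I^{\mathrm{d}}(\Omega)$: $\underline\varepsilon:=r$, $\mathrm{ev}_\varepsilon(x):=(r\odot\varphi_r(x),x)$ and $u_\varepsilon:=u\circ\mathrm{ev}_\varepsilon$ for $u\in\mathcal{E}^C(\Omega)$. Big-O: put $A_{\le e}:=\{\varepsilon\in A\mid\varepsilon\le e\}$. For a nonempty $\mathcal{J}\subseteq\mathcal{I}^{\mathrm{d}}(\Omega)$, $x_\varepsilon=O_{\mathcal{J}}(y_\varepsilon)$ means: there is $A\in\mathcal{J}$ such that for all $a\in A$ there are $H>0$ and $\varepsilon_0\in A_{\le a}$ with $|x_\varepsilon|\le H|y_\varepsilon|$ for all $\varepsilon\in A_{\le\varepsilon_0}$. $O$ without subscript is $O_{\mathcal{J}}$ with $\mathcal{J}=\mathcal{I}^{\mathrm{d}}(\Omega)$. Convention: for given $K\Subset\Omega$ and $\varphi$, $(r\odot\varphi_r(x),x)\in U(\Omega)$ for all $x$ in a neighbourhood of $K$ once $r$ is small enough; the expressions above are considered for such $r$ only, and the values assigned to the suprema for other $r$ are irrelevant. *)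

(* Defs.v *)
(* R^n is 'rV[R]_n over a realType R. *)
From HB Require Import structures.
From mathcomp Require Import all_boot all_order all_algebra.
From mathcomp Require Import all_classical all_reals all_analysis.

Set Implicit Arguments.
Unset Strict Implicit.
Unset Printing Implicit Defensive.

Import Order.TTheory GRing.Theory Num.Theory.
Import numFieldNormedType.Exports.

Local Open Scope classical_set_scope.
Local Open Scope ring_scope.

Section Smoothness.
Context {R : realType}.

(* D_{v_1} (D_{v_2} (... f)) for vs = [:: v_1; v_2; ...]. *)
Definition iter_dir {V W : normedModType R} (vs : seq V) (f : V -> W) : V -> W :=
  foldr (fun v g => 'D_v g) f vs.

(* Only used for finite-dimensional V (products of copies of R and R^k), where
   the requirement that all iterated directional derivatives exist and be
   continuous is the usual C^oo. *)
Definition Cinfty_on {V W : normedModType R} (O : set V) (f : V -> W) : Prop :=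
  forall (vs : seq V) (z : V), O z ->
    {for z, continuous (iter_dir vs f)} /\ forall v, derivable (iter_dir vs f) z v.

(* Smoothness on an arbitrary S: local smooth extendability.  On an open S this
   is Cinfty_on; the general form is needed for the endpoint r = 1 of (0,1]. *)
Definition smooth_on {V W : normedModType R} (S : set V) (f : V -> W) : Prop :=
  forall z, S z -> exists (O : set V) (g : V -> W),
    [/\ open O, O z, Cinfty_on O g & forall w, O w -> S w -> g w = f w].

Definition multidirs {n : nat} (a : 'I_n -> nat) : seq 'rV[R]_n :=
  flatten [seq nseq (a i) (delta_mx 0 i) | i <- enum 'I_n].

Definition pderiv {n : nat} (a : 'I_n -> nat) (f : 'rV[R]_n -> R) :
  'rV[R]_n -> R := iter_dir (multidirs a) f.

End Smoothness.

Section TestFunctions.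
Context {R : realType} {n : nat}.

Definition supp (f : 'rV[R]_n -> R) : set 'rV[R]_n :=
  closure [set y | f y != 0].

Definition test_function (f : 'rV[R]_n -> R) : Prop :=
  Cinfty_on setT f /\ compact (supp f).

Definition monomial (a : 'I_n -> nat) (x : 'rV[R]_n) : R :=
  \prod_(i < n) x 0 i ^+ a i.

Definition order_of (a : 'I_n -> nat) : nat := (\sum_(i < n) a i)%N.

Definition odot (r : R) (f : 'rV[R]_n -> R) : 'rV[R]_n -> R :=
  fun y => r ^- n * f (r^-1 *: y).

End TestFunctions.

(* The library has no Lebesgue measure on R^n.  The integrands below are
   continuous with compact support, and for these the iterated one-dimensional
   Lebesgue integral is the Lebesgue integral over R^n (Fubini). *)
Fixpoint integral_Rn {R : realType} (n : nat) : ('rV[R]_n -> R) -> R :=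
  match n with
  | 0%N => fun f => f 0
  | m.+1 => fun f => \int[@lebesgue_measure R]_t
      integral_Rn (fun x : 'rV[R]_m =>
        f (row_mx (const_mx t : 'rV[R]_1) x : 'rV[R]_(1 + m)))
  end.

Section Algebra.
Context {R : realType} {n : nat}.
Implicit Types (Omega K : set 'rV[R]_n) (q : nat).

Definition calA (q : nat) : set ('rV[R]_n -> R) :=
  [set f | [/\ test_function f, integral_Rn f = 1 &
    forall a : 'I_n -> nat, (1 <= order_of a <= q)%N ->
      integral_Rn (fun x => monomial a x * f x) = 0]].

Definition smooth_into_A {T : normedModType R} q (S : set T)
    (p : T -> 'rV[R]_n -> R) : Prop :=
  [/\ forall t, S t -> calA q (p t),
      smooth_on (S `*` [set: 'rV[R]_n]) (fun z : T * 'rV[R]_n => p z.1 z.2) &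
      forall t, S t -> exists L : set 'rV[R]_n, compact L /\
        \forall s \near t, S s -> supp (p s) `<=` L].

Definition U_ Omega : set (('rV[R]_n -> R) * 'rV[R]_n) :=
  [set w | [/\ calA 0 w.1, Omega w.2 &
    supp w.1 `<=` [set y | Omega (y + w.2)]]].

(* Functions on U_ Omega and on (0,1] x Omega are encoded as total functions.
   For compact K in Omega, (r (.) phi_r(x), x) lies in U_ Omega for all x in a
   neighbourhood of K once r is small, so the values of u off U_ Omega do not
   affect the asymptotic conditions below. *)
Definition EC Omega (u : ('rV[R]_n -> R) * 'rV[R]_n -> R) : Prop :=
  forall (k : nat) (W : set 'rV[R]_k)
    (p : 'rV[R]_k -> ('rV[R]_n -> R) * 'rV[R]_n),
    open W -> (forall t, W t -> U_ Omega (p t)) ->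
    smooth_into_A 0 W (fun t => (p t).1) -> smooth_on W (fun t => (p t).2) ->
    smooth_on W (u \o p).

Definition compact_in K Omega : Prop := compact K /\ K `<=` Omega.

Definition Ioc01 : set R := [set r | 0 < r <= 1].

(* C^oo_b((0,1] x Omega, A_q), identified with
   C^oo_b((0,1], C^oo(Omega, A_q)): phi_r(x) is phi r x. *)
Definition Cb q Omega (phi : R -> 'rV[R]_n -> 'rV[R]_n -> R) : Prop :=
  smooth_into_A q (Ioc01 `*` Omega) (fun t : R * 'rV[R]_n => phi t.1 t.2) /\
  forall K, compact_in K Omega -> exists B : set 'rV[R]_n, bounded_set B /\
    forall (a : 'I_n -> nat) r x, Ioc01 r -> K x ->
      supp (fun y => pderiv a (fun x' => phi r x' y) x) `<=` B.

(* sup_{x in K} |f x| in [0, +oo]; adjoining 0 makes it 0 for empty K. *)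
Definition sup_norm K (f : 'rV[R]_n -> R) : \bar R :=
  ereal_sup (0%E |` [set `|f x|%:E | x in K]).

(* f(r) = O(g(r)) as r -> 0+, for f with values in [0, +oo]. *)
Definition bigO_right0 (f : R -> \bar R) (g : R -> R) : Prop :=
  exists2 H : R, 0 < H & \forall r \near 0^'+, (f r <= (H * `|g r|)%:E)%E.

Definition ECM Omega (u : ('rV[R]_n -> R) * 'rV[R]_n -> R) : Prop :=
  EC Omega u /\
  forall K, compact_in K Omega -> forall a : 'I_n -> nat, exists N : nat,
    forall phi, Cb 0 Omega phi ->
      bigO_right0
        (fun r => sup_norm K (pderiv a (fun x => u (odot r (phi r x), x))))
        (fun r => r ^- N).

Definition NC Omega (u : ('rV[R]_n -> R) * 'rV[R]_n -> R) : Prop :=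
  ECM Omega u /\
  forall K, compact_in K Omega -> forall (a : 'I_n -> nat) (m : nat),
    exists q : nat, forall phi, Cb q Omega phi ->
      bigO_right0
        (fun r => sup_norm K (pderiv a (fun x => u (odot r (phi r x), x))))
        (fun r => r ^+ m).

End Algebra.

Section Indices.
Context {R : realType} {n : nat}.
Implicit Types Omega K : set 'rV[R]_n.

Definition Index : Type := (R * (R -> 'rV[R]_n -> 'rV[R]_n -> R))%type.

Definition Id_ Omega (q : nat) : set Index :=
  [set e | Ioc01 e.1 /\ Cb q Omega e.2].

Definition Id_family Omega : set (set Index) := range (Id_ Omega).

(* Equality of the second components is equality of maps on (0,1] x Omega. *)
Definition le_index Omega (e e' : Index) : Prop :=
  (forall r x, Ioc01 r -> Omega x -> e.2 r x = e'.2 r x) /\ e.1 <= e'.1.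

Definition ev (e : Index) (x : 'rV[R]_n) : ('rV[R]_n -> R) * 'rV[R]_n :=
  (odot e.1 (e.2 e.1 x), x).

Definition u_eps (u : ('rV[R]_n -> R) * 'rV[R]_n -> R) (e : Index) :
  'rV[R]_n -> R := u \o ev e.

Definition down_set Omega (A : set Index) (e : Index) : set Index :=
  [set e' | A e' /\ le_index Omega e' e].

Definition bigO_index Omega (J : set (set Index)) (f : Index -> \bar R)
    (g : Index -> R) : Prop :=
  exists2 A : set Index, J A & forall a, A a ->
    exists (H : R) (e0 : Index), [/\ 0 < H, down_set Omega A a e0 &
      forall e, down_set Omega A e0 e -> (`|f e| <= (H * `|g e|)%:E)%E].

End Indices.

Arguments Index : clear implicits.

(* Main.v *)
(** A point [(s, phi)] of the index set is only comparable with points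
    [(r, phi)], so for a fixed index set [Id_ Omega q] the index
    big-O says precisely that, for each [phi], the bound holds for all small
    [r].  Both equivalences follow by unfolding quantifiers.  As [le_index]
    identifies representatives that agree on [(0,1] x Omega] only, one also needs
    that partial derivatives at points of the open set [Omega] do not depend on
    values off [Omega]. *)
Require Import Defs.
From HB Require Import structures.
From mathcomp Require Import all_boot all_order all_algebra.
From mathcomp Require Import all_classical all_reals all_analysis.
Import Order.TTheory GRing.Theory Num.Theory.
Import numFieldNormedType.Exports.
Local Open Scope classical_set_scope.
Local Open Scope ring_scope.

(** A directional derivative depends only on the germ of the function. As [O] is open, agreement on
    [O] is agreement near each of its points, so it survives every differentiation. *)
Lemma iter_dir_eq_on (R : realType) (V W : normedModType R) (O : set V)
    (f g : V -> W) (vs : seq V) :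
  open O -> (forall x, O x -> f x = g x) ->
  forall x, O x -> iter_dir vs f x = iter_dir vs g x.
Proof.
move=> Oo fg; elim: vs => [|v vs IH] x Ox /=; first exact: fg.
apply: near_eq_derive; near=> y; apply: IH; near: y.
exact: open_nbhs_nbhs.
Unshelve. all: by end_near. Qed.

Lemma sup_norm_ge0 (R : realType) (n : nat) (K : set 'rV[R]_n)
    (f : 'rV[R]_n -> R) : (0 <= sup_norm K f)%E.
Proof. by apply: ereal_sup_ubound; left. Qed.

Lemma eq_sup_norm (R : realType) (n : nat) (K : set 'rV[R]_n)
    (f g : 'rV[R]_n -> R) :
  (forall x, K x -> f x = g x) -> sup_norm K f = sup_norm K g.
Proof.
move=> fg; rewrite /sup_norm; congr (ereal_sup (_ `|` _)).
by apply: eq_imagel => x /fg ->.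
Qed.

Lemma bigO_index_IdP (R : realType) (n : nat) (Omega : set 'rV[R]_n) (q : nat)
    (f : Index R n -> \bar R) (g : R -> R) :
  (forall e, (0 <= f e)%E) ->
  (forall r phi psi, Ioc01 r -> (forall x, Omega x -> phi r x = psi r x) ->
     f (r, phi) = f (r, psi)) ->
  bigO_index Omega [set Id_ Omega q] f (fun e => g e.1) <->
  forall phi, Cb q Omega phi -> bigO_right0 (fun r => f (r, phi)) g.
Proof.
move=> f_ge0 f_eq; split=> [[_ -> fOg] phi phiC | fOg].
  (* Starting from the largest parameter, [1], suffices: the index [(s, psi)] found below it
     supplies the threshold [s] for [r]. *)
  have I1 : Id_ Omega q (1, phi) by split=> //=; rewrite /Ioc01/= ltr01 lexx.
  have [H [[s psi] [H_gt0 [[/= /andP[s_gt0 s_le1] _] [/= psi_phi _]] He]]] :=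
    fOg _ I1.
  exists H => //; near=> r.
  have r01 : Ioc01 r.
    apply/andP; split; first by near: r; exact: nbhs_right_gt.
    by near: r; apply: nbhs_right_le.
  rewrite -(gee0_abs (f_ge0 _)); apply: (He (r, phi)); split; split=> //=.
    by move=> t x t01 Ox; rewrite psi_phi.
  by near: r; apply: nbhs_right_le.
exists (Id_ Omega q) => // -[s phi] [/= /andP[s_gt0 s_le1] phiC].
have [H H_gt0 Hf] := fOg phi phiC.
(* The radius of the neighbourhood is halved to include the endpoint [r = d], since the down-set of
   an index contains the index itself. *)
have [d /= d_gt0 Hd] : exists2 d, 0 < d &
    forall r, 0 < r <= d -> (f (r, phi) <= (H * `|g r|)%:E)%E.
  have [d /= d_gt0 Hd] := Hf; exists (d / 2); first by rewrite divr_gt0.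
  move=> r /andP[r_gt0 rd]; apply: Hd => //=.
  rewrite sub0r normrN gtr0_norm// (le_lt_trans rd)//.
  by rewrite ltr_pdivrMr// ltr_pMr// ltr1n.
(* The minimum is at most [s], so the index lies below [(s, phi)], and at most [d], so the bound
   holds below it. *)
exists H, (Order.min s d, phi); split=> //.
  split; split=> //=; last by rewrite ge_min lexx.
  by rewrite /Ioc01/= lt_min s_gt0 d_gt0 ge_min s_le1.
move=> [r psi] [[/= r01 _] [/= psi_phi]]; rewrite le_min => /andP[_ r_le].
rewrite gee0_abs// (f_eq _ _ phi r01) => [|x Ox]; last exact: psi_phi.
by apply: Hd; rewrite r_le andbT; have /andP[] := r01.
Unshelve. all: by end_near. Qed.

(** Serves both parts of the theorem, with [g] a negative power of [r] for moderateness and a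
    positive one for negligibility. *)
Lemma sup_norm_u_epsP (R : realType) (n : nat) (Omega : set 'rV[R]_n)
    (u : ('rV[R]_n -> R) * 'rV[R]_n -> R) (K : set 'rV[R]_n) (a : 'I_n -> nat)
    (q : nat) (g : R -> R) :
  open Omega -> K `<=` Omega ->
  bigO_index Omega [set Id_ Omega q]
    (fun e => sup_norm K (pderiv a (u_eps u e))) (fun e => g e.1) <->
  forall phi, Cb q Omega phi ->
    bigO_right0
      (fun r => sup_norm K (pderiv a (fun x => u (odot r (phi r x), x)))) g.
Proof.
move=> Oo KO; apply: bigO_index_IdP => [e | r phi psi _ eq_phi].
  exact: sup_norm_ge0.
apply: eq_sup_norm => x /KO; apply: iter_dir_eq_on => // y Oy.
by rewrite /u_eps /ev /= eq_phi.
Qed.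

Theorem theorem34 (R : realType) (n : nat) (n_gt0 : (0 < n)%N)
    (Omega : set 'rV[R]_n) (Omega_open : open Omega)
    (u : ('rV[R]_n -> R) * 'rV[R]_n -> R) (u_EC : EC Omega u) :
  (ECM Omega u <->
    forall K : set 'rV[R]_n, compact_in K Omega ->
    forall a : 'I_n -> nat, exists N : nat,
      bigO_index Omega [set Id_ Omega 0]
        (fun e => sup_norm K (pderiv a (u_eps u e))) (fun e => e.1 ^- N))
  /\
  (ECM Omega u ->
    (NC Omega u <->
      forall K : set 'rV[R]_n, compact_in K Omega ->
      forall (a : 'I_n -> nat) (m : nat),
        bigO_index Omega (Id_family Omega)
          (fun e => sup_norm K (pderiv a (u_eps u e))) (fun e => e.1 ^+ m))).
Proof.
split; first split=> [[_ uM] K KO a | uM].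
- have [N HN] := uM K KO a; exists N.
  by apply/(sup_norm_u_epsP _ _ _ _ _ _ _ (fun r => r ^- N)) => //; case: KO.
- split=> // K KO a; have [N HN] := uM K KO a; exists N.
  by apply/(sup_norm_u_epsP _ _ _ _ _ _ _ (fun r => r ^- N)) => //; case: KO.
move=> uM; split=> [[_ uN] K KO a m | uN].
  have [q /(sup_norm_u_epsP _ _ _ _ _ _ _ _ Omega_open KO.2)[_ -> H]] :=
    uN K KO a m.
  (* Choosing a member of [Id_family Omega] is the same as choosing [q]. *)
  by exists (Id_ Omega q) => //; exists q.
split=> // K KO a m; have [_ [q _ <-] H] := uN K KO a m; exists q.
apply/(sup_norm_u_epsP _ _ _ _ _ _ _ (fun r => r ^+ m)) => //; first by case: KO.
by exists (Id_ Omega q).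
Qed.
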